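(* Let $\mathbf{r}=(r_1,\dots,r_n)$ be a sequence of integers with $1\le r_1\le r_2\le\cdots\le r_n\le n$ and $r_k\ge k$ for all $k$. Then \[ \sum_{\sigma\in S_{\mathbf r}} q^{\mathrm{inv}(\sigma)}\prod_{i\in \mathrm{Rlminl}(\sigma)}t_i=\prod_{k=1}^n\left(t_k+q+q^2+\cdots+q^{h_k-1}\right), \] where $(h_1,\dots,h_n)$ is the height sequence of the Dyck path $D(\mathbf r)$. In particular, \[ \sum_{\sigma\in S_{\mathbf r}} q^{\mathrm{inv}(\sigma)}t^{\mathrm{rlminl}(\sigma)}=\prod_{k=1}^n\left(t+q+q^2+\cdots+q^{r_k-k}\right). \]
   Context: Here $q,t,t_1,\dots,t_n$ are indeterminates, and $q+q^2+\cdots+q^{m}$ denotes $\sum_{j=1}^{m}q^j$ (which is $0$ if $m=0$). $S_n$ is the symmetric group on $\{1,\dots,n\}$ and $S_{\mathbf r}=\{\sigma\in S_n:\sigma(k)\le r_k,\ 1\le k\le n\}$. $\mathrm{inv}(\sigma)$ is the number of pairs $i<j$ with $\sigma(i)>\sigma(j)$. $\mathrm{Rlminl}(\sigma)$ is the set of right-to-left minimum letters: the set of values $\sigma(i)$ such that $\sigma(i)<\sigma(j)$ for all $j>i$; $\mathrm{rlminl}(\sigma)=|\mathrm{Rlminl}(\sigma)|$. A Dyck path of semilength $n$ is a lattice path from $(0,0)$ to $(2n,0)$ with steps $(1,1)$ (rises) and $(1,-1)$ (falls) never going below the $x$-axis. The height of a rise is the $y$-coordinate of its right endpoint; the height sequence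 is the sequence $(h_1,\dots,h_n)$ of heights of the rises read from left to right. $D(\mathbf r)$ is the unique Dyck path of semilength $n$ whose $k$-th fall is preceded by exactly $r_k$ rises, for every $k$. *)

(* Defs.v *)
From mathcomp Require Import all_boot all_order all_fingroup all_algebra.
From mathcomp Require Export mpoly.

Set Implicit Arguments.
Unset Strict Implicit.
Unset Printing Implicit Defensive.

Import GRing.Theory Num.Theory.

(* Positions and letters 1, ..., n are represented by the ordinals 0, ..., n-1
   of 'I_n, so the letter sigma(k) is (s k).+1 for s : 'S_n. *)

(* Since letters are shifted by one, sigma(k) <= r_k reads s k < r_k. *)
Definition restricted_perms n (r : n.-tuple nat) : {set 'S_n} :=
  [set s : 'S_n | [forall k : 'I_n, s k < tnth r k]].

Definition inv_count n (s : 'S_n) : nat :=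
  #|[set p : 'I_n * 'I_n | (p.1 < p.2) && (s p.2 < s p.1)]|.

Definition Rlminl n (s : 'S_n) : {set 'I_n} :=
  [set s i | i : 'I_n & [forall j : 'I_n, (i < j) ==> (s i < s j)]].

Definition rlminl n (s : 'S_n) : nat := #|Rlminl s|.

(* A lattice path from the origin is its word of steps: true is the rise (1,1),
   false is the fall (1,-1). Its endpoint is (size s, ycoord s). *)
Definition ycoord (s : seq bool) : int :=
  (\sum_(b <- s) (if b then 1 else -1))%R.

Definition dyck n (s : seq bool) : bool :=
  [&& size s == n.*2, ycoord s == 0%R
    & [forall i : 'I_(size s).+1, (0 <= ycoord (take i s))%R]].

(* The absolute value only casts int to nat: along a Dyck path the ordinates
   are nonnegative. *)
Definition height_seq (s : seq bool) : seq nat :=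
  [seq `|ycoord (take i.+1 s)|%N | i <- iota 0 (size s) & nth false s i].

(* The k-th entry is the number of rises preceding the k-th fall. *)
Definition rises_before_falls (s : seq bool) : seq nat :=
  [seq count id (take i s) | i <- iota 0 (size s) & ~~ nth false s i].

Definition is_dyck_path_of n (r : n.-tuple nat) (s : seq bool) : Prop :=
  dyck n s /\ rises_before_falls s = r.

(* q + q^2 + ... + q^m *)
Definition qsum (R : pzRingType) (q : R) (m : nat) : R :=
  (\sum_(1 <= j < m.+1) q ^+ j)%R.

Lemma rises_before_falls_cons b s :
  rises_before_falls (b :: s) =
  if b then map succn (rises_before_falls s) else 0 :: rises_before_falls s.
Proof.
rewrite /rises_before_falls /= -[1]/(1 + 0) iotaDl filter_map -map_comp.
by case: b => //=; rewrite -map_comp.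
Qed.

Lemma rises_before_falls_cat s1 s2 :
  rises_before_falls (s1 ++ s2) =
  rises_before_falls s1 ++ map (addn (count id s1)) (rises_before_falls s2).
Proof.
elim: s1 => [|b s1 IH] /=; first by rewrite map_id.
rewrite !rises_before_falls_cons IH; case: b => //=.
by rewrite map_cat -map_comp.
Qed.

Lemma size_rises_before_falls s : size (rises_before_falls s) = count negb s.
Proof.
elim: s => [|[] s IH] //; rewrite rises_before_falls_cons /= ?add0n ?add1n.
- by rewrite size_map.
- by rewrite IH.
Qed.

Lemma rises_before_falls_le s x :
  x \in rises_before_falls s -> x <= count id s.
Proof.
elim: s x => [|[] s IH] x; rewrite ?rises_before_falls_cons //=.
- by case/mapP => y /IH le_y ->; rewrite add1n ltnS.
- by rewrite inE add0n => /orP[/eqP -> //|/IH].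
Qed.

Lemma rises_before_falls_inj s1 s2 :
  count id s1 = count id s2 ->
  rises_before_falls s1 = rises_before_falls s2 -> s1 = s2.
Proof.
have allT s : rises_before_falls s = [::] -> s = nseq (count id s) true.
  elim: s => [|[] s IH] //; rewrite rises_before_falls_cons //=.
  by case: (rises_before_falls s) IH => // IH _; rewrite {1}IH.
elim: s1 s2 => [|[] s1 IH] [|[] s2] //=;
  rewrite ?rises_before_falls_cons ?add0n ?add1n //=.
- by move=> [eqc] /(inj_map succn_inj) /(IH _ eqc) ->.
- by move=> _; case: (rises_before_falls s1).
- by move=> _; case: (rises_before_falls s2).
- by move=> eqc [] /(IH _ eqc) ->.
Qed.

Lemma ycoordE s : ycoord s = ((count id s)%:Z - (count negb s)%:Z)%R.
Proof.
elim: s => [|b s]; rewrite /ycoord ?big_nil ?big_cons //= => ->.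
by case: b; rewrite /= !PoszD ?add0r ?opprD !addrA // addrAC [(-1 + _)%R]addrC.
Qed.

Lemma exists_unique_dyck_path n (r : n.-tuple nat) :
  (forall i j : 'I_n, i <= j -> tnth r i <= tnth r j) ->
  (forall k : 'I_n, k < tnth r k <= n) ->
  exists! s : seq bool, is_dyck_path_of r s.
Proof.
move=> r_mono r_bnd.
have dyck_count s : dyck n s -> count id s = n.
  case/and3P => /eqP szs + _; rewrite ycoordE subr_eq0 => /eqP[eqc].
  by move: (count_predC id s); rewrite szs -[X in _ + X]eqc addnn => /double_inj.
have build : forall (l : seq nat) a m, path leq a l -> all (geq m) l ->
    a <= m -> exists2 s, count id s = m - a &
    map (addn a) (rises_before_falls s) = l.
  elim=> [|x l IH] a m /=.
    move=> _ _ le_am; exists (nseq (m - a) true).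
      by rewrite count_nseq mul1n.
    elim: (m - a) => //= k IHk; rewrite rises_before_falls_cons /=.
    by case: (rises_before_falls _) IHk.
  case/andP=> le_ax pl /andP[le_xm lem] _.
  have [s cs rs] := IH x m pl lem le_xm.
  exists (nseq (x - a) true ++ false :: s).
    by rewrite count_cat count_nseq /= mul1n cs add0n addnC addnBA // subnK.
  have rT k : rises_before_falls (nseq k true) = [::].
    by elim: k => //= k IHk; rewrite rises_before_falls_cons IHk.
  rewrite rises_before_falls_cat rT cat0s count_nseq mul1n.
  rewrite rises_before_falls_cons -map_comp /= addn0 subnKC //; congr (_ :: _).
  rewrite -[RHS]rs; apply: eq_map => y /=.
  by rewrite addnA subnKC.
have path_r : path leq 0 r.
  apply/(pathP 0) => i; rewrite size_tuple => lt_in.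
  case: i lt_in => [|i] // lt_in /=.
  have := r_mono (Ordinal (ltnW lt_in)) (Ordinal lt_in) (leqnSn i).
  by rewrite !(tnth_nth 0).
have all_r : all (geq n) r.
  by apply/allP => x /tnthP[k ->]; case/andP: (r_bnd k).
have [s cs rs] := build r 0 n path_r all_r (leq0n n).
rewrite subn0 in cs; rewrite map_id in rs.
have cNs : count negb s = n by rewrite -size_rises_before_falls rs size_tuple.
exists s; split=> [|s' [ds' rs']]; last first.
  by apply: rises_before_falls_inj; rewrite ?cs ?(dyck_count s') // rs.
split=> //; apply/and3P; split.
- by rewrite -(count_predC id s) cs -addnn -[X in _ == _ + X]cNs.
- by rewrite ycoordE cs cNs subrr.
- apply/forallP => i; rewrite ycoordE subr_ge0 lez_nat.
  set s1 := take i s; rewrite -size_rises_before_falls.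
  have rE : rises_before_falls s = rises_before_falls s1 ++
      map (addn (count id s1)) (rises_before_falls (drop i s)).
    by rewrite -rises_before_falls_cat cat_take_drop.
  case E: (size (rises_before_falls s1)) => [|k] //.
  have lt_kn : k < n.
    by rewrite -(size_tuple r) -rs rE size_cat E ltnS leq_addr.
  have /andP[lt_kr _] := r_bnd (Ordinal lt_kn).
  apply: leq_trans lt_kr _; rewrite (tnth_nth 0) /= -rs rE nth_cat E ltnS leqnn.
  by apply: rises_before_falls_le; rewrite mem_nth // E.
Qed.

(* Main.v *)
(* Encode s by its Lehmer code c_i = #{j > i : s j < s i}: then inv s is the sum
   of the c_i, and s i is a right-to-left minimum iff c_i = 0. Choosing
   s 0, s 1, ... in turn, the constraint s i < r i with r nondecreasing leaves
   for c_i exactly the values 0, ..., r i - i - 1, independently of the previous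
   choices; this gives the second identity. Conjugating s^-1 by the reversal of
   'I_n turns the same count into one indexed by letters: letter j may only
   occupy the positions from f j = #{p : r p <= j} on, so that its code ranges
   over 0, ..., j - f j, and j + 1 - f j is the height of the corresponding
   rise, which is preceded by j rises and f j falls. *)
Require Import Defs.
From mathcomp Require Import all_boot all_order all_fingroup all_algebra.
From mathcomp Require Import zify.

Set Implicit Arguments.
Unset Strict Implicit.
Unset Printing Implicit Defensive.

Import GRing.Theory Num.Theory.
Local Open Scope ring_scope.

(** * Lehmer codes, inversions and right-to-left minima *)

Definition lehmer n (s : 'S_n) (i : 'I_n) : nat :=
  #|[set j : 'I_n | (i < j)%N && (s j < s i)%N]|.

Lemma inv_count_lehmer n (s : 'S_n) : inv_count s = (\sum_i lehmer s i)%N.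
Proof.
rewrite /inv_count -sum1_card.
rewrite (eq_bigl (fun p : 'I_n * 'I_n => true && ((p.1 < p.2)%N && (s p.2 < s p.1)%N)));
  last by move=> p; rewrite inE.
rewrite -(pair_big_dep xpredT (fun i j : 'I_n => (i < j)%N && (s j < s i)%N)
  (fun _ _ => 1%N)) /=.
by apply: eq_bigr => i _; rewrite /lehmer -sum1_card; apply: eq_bigl => j; rewrite inE.
Qed.

Lemma lehmer_eq0 n (s : 'S_n) i :
  (lehmer s i == 0%N) = [forall j : 'I_n, (i < j)%N ==> (s i < s j)%N].
Proof.
rewrite /lehmer cards_eq0; apply/eqP/forallP => [E j|H].
  apply/implyP => lt_ij; move/setP/(_ j): E; rewrite !inE lt_ij /= => /negbT.
  rewrite -leqNgt leq_eqVlt => /orP[/eqP/val_inj/perm_inj ij|//].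
  by rewrite ij ltnn in lt_ij.
apply/setP => j; rewrite !inE; have /implyP := H j.
by case: ltnP => //= _ /(_ isT); lia.
Qed.

Lemma prod_Rlminl (R : comPzRingType) n (s : 'S_n) (t : 'I_n -> R) :
  \prod_(i in Rlminl s) t i = \prod_i (if lehmer s i == 0%N then t (s i) else 1).
Proof.
rewrite /Rlminl big_imset /=; last by move=> i j _ _; apply: perm_inj.
rewrite -big_mkcond; apply: eq_bigl => i.
by rewrite lehmer_eq0 inE.
Qed.

(** * Splitting off the first letter *)

Lemma lehmer_lift_perm0 n (i : 'I_n.+1) (s : 'S_n) :
  lehmer (lift_perm ord0 i s) ord0 = i.
Proof.
rewrite /lehmer lift_perm_id.
transitivity #|[set j : 'I_n.+1 | (j < i)%N]|; last first.
  rewrite -sum1dep_card -(big_ord_widen _ (fun=> 1%N) (ltnW (ltn_ord i))).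
  by rewrite sum1_card card_ord.
(* Count letters instead of positions: every letter below [i] occurs after position 0, which holds
   [i] itself. *)
rewrite -(card_imset _ (@perm_inj _ (lift_perm ord0 i s))).
apply: eq_card => j; rewrite inE; apply/imsetP/idP => [[k]|lt_ji].
  by rewrite inE => /andP[_ ?] ->.
exists ((lift_perm ord0 i s)^-1%g j); last by rewrite permKV.
rewrite inE permKV lt_ji andbT lt0n; apply/eqP => k0.
have E : (lift_perm ord0 i s)^-1%g j = ord0 by apply: val_inj.
have /(congr1 (lift_perm ord0 i s)) := E; rewrite permKV lift_perm_id => ji.
by rewrite ji ltnn in lt_ji.
Qed.

Lemma ltn_lift n (i : 'I_n.+1) (j k : 'I_n) :
  (lift i j < lift i k)%N = (j < k)%N.
Proof. by rewrite /= /bump; do 2![case: leqP => /=]; lia. Qed.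

Lemma lehmer_lift_perm n (i : 'I_n.+1) (s : 'S_n) k :
  lehmer (lift_perm ord0 i s) (lift ord0 k) = lehmer s k.
Proof.
rewrite /lehmer -[RHS](card_imset _ (@lift_inj _ ord0)).
apply: eq_card => j; rewrite inE; apply/andP/imsetP => [[]|[m]].
  case: (unliftP ord0 j) => [m ->|-> //].
  rewrite !lift_perm_lift !ltn_lift => lt1 lt2.
  by exists m; rewrite // inE lt1.
by rewrite inE => /andP[lt1 lt2] ->; rewrite !lift_perm_lift !ltn_lift.
Qed.

Lemma lift_perm_bij n : bijective
  (fun p : 'I_n.+1 * 'S_n => lift_perm ord0 p.1 p.2).
Proof.
apply: inj_card_bij; last by rewrite card_prod !card_Sn card_ord factS.
move=> [i s] [j u] /= E.
have ij : i = j by rewrite -(lift_perm_id ord0 i s) E lift_perm_id.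
subst j; congr (_, _); apply/permP => k; apply: (@lift_inj _ i).
by rewrite -!(lift_perm_lift ord0) E.
Qed.

(** Induction on [n]: the first letter [i] is its own code, and deleting it leaves the same problem
    with bounds that do not depend on [i], so the sum over [i] factors out. *)
Lemma sum_lehmer_position (R : comPzRingType) n (r : 'I_n -> nat)
    (w : 'I_n -> nat -> R) :
  (forall i j : 'I_n, (i <= j)%N -> (r i <= r j)%N) ->
  (forall i, (r i <= n)%N) ->
  \sum_(s : 'S_n | [forall k, (s k < r k)%N]) \prod_k w k (lehmer s k)
  = \prod_(k < n) \sum_(c < r k - k) w k c.
Proof.
elim: n => [|n IH] in r w * => r_mono r_le.
  rewrite big_ord0 (big_pred1 1%g) ?big_ord0 // => s.
  transitivity true; first by apply/forallP => -[].
  by apply/esym/eqP/permP => -[].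
rewrite (reindex _ (onW_bij _ (lift_perm_bij n))) /=.
(* Since [i < r ord0 <= r (lift ord0 k)], the deleted letter always lies below the later bounds, and
   each of them drops by exactly one. *)
rewrite (eq_bigl (fun p : 'I_n.+1 * 'S_n => (p.1 < r ord0)%N
    && [forall k, (p.2 k < r (lift ord0 k) - 1)%N])); last first.
  case=> i s /=; apply/forallP/andP => [H|[lt_i /forallP H] k].
    have := H ord0; rewrite lift_perm_id => lt_i; split=> //; apply/forallP => k.
    have := H (lift ord0 k); rewrite lift_perm_lift /= /bump.
    have := r_mono ord0 (lift ord0 k) (leq0n _).
    by case: leqP => /=; lia.
  case: (unliftP ord0 k) => [m|] ->; last by rewrite lift_perm_id.
  rewrite lift_perm_lift; have := H m; rewrite /= /bump.
  by case: leqP => /=; lia.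
rewrite -(pair_big (fun i : 'I_n.+1 => (i < r ord0)%N)
  (fun s : 'S_n => [forall k, (s k < r (lift ord0 k) - 1)%N])
  (fun i s => \prod_k w k (lehmer (lift_perm ord0 i s) k))) /=.
under eq_bigr => i _.
  under eq_bigr => s _.
    rewrite big_ord_recl lehmer_lift_perm0.
    under eq_bigr => k _ do rewrite lehmer_lift_perm.
    over.
  rewrite -mulr_sumr.
  over.
rewrite big_ord_recl -mulr_suml; congr (_ * _).
  by rewrite subn0 (big_ord_widen _ (w ord0) (r_le ord0)).
rewrite (IH (fun k => r (lift ord0 k) - 1)%N (fun k => w (lift ord0 k))).
- apply: eq_bigr => k _.
  have -> // : (r (lift ord0 k) - 1 - k = r (lift ord0 k) - lift ord0 k)%N.
  by rewrite [in RHS]/= /bump leq0n; lia.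
- by move=> i j le_ij; apply/leq_sub2r/r_mono; rewrite /= /bump !leq0n.
- by move=> i; have := r_le (lift ord0 i); lia.
Qed.

(** * From positions to letters *)

(** Reflection of the permutation diagram in its antidiagonal: the point [(i, s i)] goes to
    [(rev_ord (s i), rev_ord i)]. *)
Definition rev_inv_perm n (s : 'S_n) : 'S_n :=
  (perm (@rev_ord_inj n) * s^-1 * perm (@rev_ord_inj n))%g.

Lemma rev_inv_permE n (s : 'S_n) k :
  rev_inv_perm s k = rev_ord (s^-1%g (rev_ord k)).
Proof. by rewrite !permM !permE. Qed.

Lemma rev_inv_permK n : involutive (@rev_inv_perm n).
Proof.
move=> s; have rev2 : (perm (@rev_ord_inj n) * perm (@rev_ord_inj n) = 1)%g.
  by apply/permP => k; rewrite permM !permE rev_ordK.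
have revV := mulg1_eq rev2.
by rewrite /rev_inv_perm !invMg revV invgK !mulgA rev2 mul1g -!mulgA rev2 mulg1.
Qed.

Lemma ltn_rev_ord n (i j : 'I_n) : (rev_ord i < rev_ord j)%N = (j < i)%N.
Proof. by have := ltn_ord i; have := ltn_ord j; rewrite /=; lia. Qed.

(** The reflection exchanges the two conditions counted by the code, being later and being
    smaller. *)
Lemma lehmer_rev_inv n (s : 'S_n) k :
  lehmer (rev_inv_perm s) k = lehmer s (s^-1%g (rev_ord k)).
Proof.
have g_inj : injective (fun i => rev_ord (s i)).
  by move=> i j /rev_ord_inj/perm_inj.
rewrite /lehmer -[RHS](card_imset _ g_inj).
apply: eq_card => j; rewrite inE !rev_inv_permE ltn_rev_ord.
apply/andP/imsetP => [[lt1 lt2]|[i]].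
  exists (s^-1%g (rev_ord j)); last by rewrite permKV rev_ordK.
  by rewrite inE lt2 !permKV ltn_rev_ord.
rewrite inE permKV => /andP[lt1 lt2] ->.
by rewrite rev_ordK permK -(rev_ordK k) ltn_rev_ord rev_ordK.
Qed.

(** The reflection turns lower bounds on the position of each letter into upper bounds on the letter
    at each position. *)
Lemma sum_lehmer_letter (R : comPzRingType) n (f : 'I_n -> nat)
    (w : 'I_n -> nat -> R) :
  (forall i j : 'I_n, (i <= j)%N -> (f i <= f j)%N) ->
  \sum_(s : 'S_n | [forall k, (f (s k) <= k)%N]) \prod_k w (s k) (lehmer s k)
  = \prod_(j < n) \sum_(c < j.+1 - f j) w j c.
Proof.
move=> f_mono.
have rev_bij : bijective (@rev_ord n) := inv_bij (@rev_ordK n).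
transitivity (\sum_(s : 'S_n | [forall k, (s k < n - f (rev_ord k))%N])
    \prod_k w (rev_ord k) (lehmer s k)).
  rewrite [RHS](reindex _ (onW_bij _ (inv_bij (@rev_inv_permK n)))) /=.
  apply: eq_big => [s|s _].
    apply/forallP/forallP => H k.
      rewrite rev_inv_permE; have := H (s^-1%g (rev_ord k)); rewrite permKV /=.
      by have := ltn_ord (s^-1%g (rev_ord k)); lia.
    have := H (rev_ord (s k)); rewrite rev_inv_permE rev_ordK permK /=.
    by have := ltn_ord k; lia.
  (* The factor of [s] at position [k] is that of the reflected permutation at position
     [rev_ord (s k)]. *)
  rewrite [RHS](reindex (fun k => rev_ord (s k))) /=; last first.
    exists (fun k => s^-1%g (rev_ord k)) => k _; first by rewrite rev_ordK permK.
    by rewrite permKV rev_ordK.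
  by apply: eq_bigr => k _; rewrite lehmer_rev_inv rev_ordK permK.
rewrite (sum_lehmer_position (r := fun k => n - f (rev_ord k))%N
  (fun k => w (rev_ord k))).
- rewrite (reindex _ (onW_bij _ rev_bij)) /=.
  apply: eq_bigr => k _; rewrite rev_ordK.
  have -> // : (n - f k - (n - k.+1) = k.+1 - f k)%N.
  by have := ltn_ord k; lia.
- by move=> i j le_ij; apply/leq_sub2l/f_mono => /=; lia.
- by move=> i; exact: leq_subr.
Qed.

(** * Heights of the rises of a path *)

Definition rise_indices (s : seq bool) : seq nat :=
  [seq i <- iota 0 (size s) | nth false s i].

Lemma rise_indices_cons b s :
  rise_indices (b :: s) =
  if b then 0%N :: map succn (rise_indices s) else map succn (rise_indices s).
Proof. by rewrite /rise_indices /= -[1%N]/(1 + 0)%N iotaDl filter_map. Qed.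

Lemma size_rise_indices s : size (rise_indices s) = count id s.
Proof.
by elim: s => [|[] s IH] //; rewrite rise_indices_cons /= size_map IH.
Qed.

(* The falls before the k-th rise are those preceded by at most k rises. *)
Lemma nth_height_seq s k : (k < count id s)%N ->
  nth 0%N (height_seq s) k =
  `|k.+1%:Z - (count (leq^~ k) (rises_before_falls s))%:Z|%N.
Proof.
rewrite -size_rise_indices => lt_k; rewrite (nth_map 0%N) //; congr absz.
rewrite -/(rise_indices s); elim: s k lt_k => // b s IH k.
rewrite rise_indices_cons rises_before_falls_cons.
have ycons x : ycoord (b :: x) = (if b then 1 else -1) + ycoord x.
  by rewrite /ycoord big_cons.
case: b ycons => ycons.
  case: k => [_|k] /=.
    (* After a leading rise every fall has a rise before it, so no entry is 0. *)
    rewrite take0 ycons /ycoord big_nil count_map (@eq_count _ _ pred0) //.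
    by rewrite count_pred0.
  rewrite ltnS size_map => lt_k.
  rewrite (nth_map 0%N) //= ycons IH // count_map.
  by rewrite (@eq_count _ _ (leq^~ k)) //; lia.
rewrite size_map => lt_k.
by rewrite (nth_map 0%N) //= ycons IH //; lia.
Qed.

(** * Local weights and the two identities *)

Lemma sum_lehmer_weight (R : pzRingType) (q t : R) m :
  \sum_(c < m.+1) q ^+ c * (if c == 0%N :> nat then t else 1) = t + qsum q m.
Proof.
rewrite big_ord_recl mul1r /qsum big_add1 big_mkord; congr (_ + _).
by apply: eq_bigr => c _; rewrite mulr1.
Qed.

Lemma inv_Rlminl_lehmer (R : comPzRingType) n (s : 'S_n) (q : R) t :
  q ^+ inv_count s * \prod_(i in Rlminl s) t i =
  \prod_i (q ^+ lehmer s i * (if lehmer s i == 0%N then t (s i) else 1)).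
Proof.
by rewrite inv_count_lehmer prod_Rlminl big_split /= -expr_sum.
Qed.

(** The entries at most [j] form a prefix of a sorted sequence, and their count is its length. *)
Lemma ltn_nth_sorted s j k : sorted leq s -> (k < size s)%N ->
  (j < nth 0%N s k)%N = (count (leq^~ j) s <= k)%N.
Proof.
elim: s k => // x s IH k pxs lt_k /=.
have /allP ge_x := order_path_min leq_trans pxs.
case: (leqP x j) => [le_xj|lt_jx]; last first.
  have -> : count (leq^~ j) s = 0%N.
    rewrite (@eq_in_count _ _ pred0) ?count_pred0 // => y /ge_x /= le_xy.
    by rewrite leqNgt (leq_trans lt_jx le_xy).
  case: k lt_k => //= k lt_k; apply: leq_trans lt_jx _.
  by apply/ge_x/mem_nth.
case: k lt_k => [|k] /= lt_k; first by rewrite ltnNge le_xj.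
by rewrite IH // (path_sorted pxs).
Qed.

(* First identity: in Z[q, t_1, ..., t_n], with q = 'X_0 and t_k = 'X_k.
   Second identity: in Z[q, t], with q = 'X_0 and t = 'X_1.
   The ordinal k : 'I_n stands for the 1-based index k.+1. *)
Theorem corollary2p9 (n : nat) (r : n.-tuple nat)
    (r_range : forall k : 'I_n, (1 <= tnth r k <= n)%N)
    (r_mono : forall i j : 'I_n, (i <= j)%N -> (tnth r i <= tnth r j)%N)
    (r_ge : forall k : 'I_n, (k.+1 <= tnth r k)%N) :
  (forall D : seq bool, is_dyck_path_of r D ->
     let q : {mpoly int[n.+1]} := 'X_ord0 in
     let t (k : 'I_n) : {mpoly int[n.+1]} := 'X_(lift ord0 k) in
     \sum_(s in restricted_perms r) q ^+ inv_count s * \prod_(i in Rlminl s) t i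
     = \prod_(k < n) (t k + qsum q (nth 0%N (height_seq D) k - 1)))
  /\
  (let q : {mpoly int[2]} := 'X_ord0 in
   let t : {mpoly int[2]} := 'X_ord_max in
   \sum_(s in restricted_perms r) q ^+ inv_count s * t ^+ rlminl s
   = \prod_(k < n) (t + qsum q (tnth r k - k.+1))).
Proof.
split=> [D [dyckD rD] q t|q t].
  (* [f j] counts the falls of [D] before rise [j]; by [ltf] it is also the first position open to
     letter [j]. *)
  pose f (j : 'I_n) := count (leq^~ (j : nat)) r.
  have r_sorted : sorted leq r.
    apply/(sortedP 0%N) => i; rewrite size_tuple => lt_in.
    have := r_mono (Ordinal (ltnW lt_in)) (Ordinal lt_in) (leqnSn i).
    by rewrite !(tnth_nth 0%N).
  have ltf (k j : 'I_n) : (j < tnth r k)%N = (f j <= k)%N.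
    by rewrite (tnth_nth 0%N) ltn_nth_sorted ?size_tuple.
  have f_mono (i j : 'I_n) : (i <= j)%N -> (f i <= f j)%N.
    by move=> le_ij; apply: sub_count => x /= /leq_trans; apply.
  have sizeD : count id D = n.
    case/and3P: dyckD => /eqP szD _ _; have := count_predC id D.
    have := size_rises_before_falls D; rewrite rD size_tuple szD => <-; lia.
  rewrite (eq_bigl (fun s : 'S_n => [forall k, (f (s k) <= k)%N])); last first.
    by move=> s; rewrite inE; apply: eq_forallb => k; rewrite ltf.
  under eq_bigr => s _ do rewrite inv_Rlminl_lehmer.
  rewrite (sum_lehmer_letter
    (fun j c => q ^+ c * (if c == 0%N :> nat then t j else 1)) f_mono).
  apply: eq_bigr => j _.
  (* Hence the height [j.+1 - f j] is positive: the cast by absolute value is harmless, and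
     subtracting 1 gives [j - f j] without truncation. *)
  have le_f : (f j <= j)%N by rewrite -ltf.
  by rewrite nth_height_seq ?sizeD // rD subSn // sum_lehmer_weight;
    congr (_ + qsum _ _); rewrite /f in le_f *; lia.
have rlminlE (s : 'S_n) : t ^+ rlminl s = \prod_(i in Rlminl s) t.
  by rewrite prodr_const.
under eq_bigr => s _ do rewrite rlminlE inv_Rlminl_lehmer.
rewrite (eq_bigl (fun s : 'S_n => [forall k, (s k < tnth r k)%N])); last first.
  by move=> s; rewrite inE.
rewrite (sum_lehmer_position
  (fun j c => q ^+ c * (if c == 0%N :> nat then t else 1)) r_mono); last first.
  by move=> k; case/andP: (r_range k).
apply: eq_bigr => k _.
(* The successor form separates code 0, which carries [t], from the positive powers of [q]. *)
have -> : (tnth r k - k = (tnth r k - k.+1).+1)%N by have := r_ge k; lia.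
exact: sum_lehmer_weight.
Qed.
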